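(* Let $\Delta$ be a shellable simplicial complex with $n$ vertices $x_1,\dots,x_n$. Then the $(s_1,\dots,s_n)$-expansion $\Delta^{(s_1,\dots,s_n)}$ is shellable for all positive integers $s_1,\dots,s_n$.
   Context: Simplicial complexes are finite; $\mathcal{F}(\Delta)$ denotes the set of facets (maximal faces) of $\Delta$, and $[s]=\{1,\dots,s\}$. Expansion: for a simplicial complex $\Delta$ with vertex set $\{x_1,\dots,x_n\}$ and positive integers $s_1,\dots,s_n$, the $(s_1,\dots,s_n)$-expansion $\Delta^{(s_1,\dots,s_n)}$ is the simplicial complex with vertex set $\{x_{11},\dots,x_{1s_1},x_{21},\dots,x_{2s_2},\dots,x_{n1},\dots,x_{ns_n}\}$ whose facets are exactly the sets $\{x_{i_1r_1},\dots,x_{i_kr_k}\}$ where $\{x_{i_1},\dots,x_{i_k}\}\in\mathcal{F}(\Delta)$ with $i_1<\cdots<i_k$ and $(r_1,\dots,r_k)\in[s_{i_1}]\times\cdots\times[s_{i_k}]$. Shellable (in the non-pure sense): $\Delta$ is shellable if there exists an ordering $F_1<\cdots<F_m$ of all the facets of $\Delta$ such that for any $i<j$ there exist a vertex $v\in F_j\setminus F_i$ and an index $\ell<j$ with $F_j\setminus F_\ell=\{v\}$. *)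

(* Defs.v *)
From mathcomp Require Import all_boot.

Set Implicit Arguments.
Unset Strict Implicit.
Unset Printing Implicit Defensive.

(* Every element of the finite type V is required to be a vertex, so that V is
   exactly the vertex set.  The empty set is automatically a face as soon as V
   is inhabited; for empty V both the void complex and {set0} are allowed. *)
Record simplicial_complex (V : finType) := SimplicialComplex {
  faces : {set {set V}};
  face_vertex : forall v : V, [set v] \in faces;
  face_sub : forall F G : {set V}, F \in faces -> G \subset F -> G \in faces
}.

Definition facets (V : finType) (D : simplicial_complex V) : {set {set V}} :=
  [set F | maxset (fun G => G \in faces D) F].

Definition shellable (V : finType) (D : simplicial_complex V) : Prop :=
  exists Fs : seq {set V},
    [/\ uniq Fs,
        Fs =i facets D
      & forall i j : nat, i < j -> j < size Fs ->
          exists2 v : V, v \in nth set0 Fs j :\: nth set0 Fs i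
          & exists2 l : nat, l < j
            & nth set0 Fs j :\: nth set0 Fs l = [set v]].

Section Expansion.

Variables (I : finType) (D : simplicial_complex I) (s : I -> nat).

(* The copy x_ir of x_i is the pair of i and r : 'I_(s i); the copies of x_i
   are thus numbered from 0 to s i - 1. *)
Definition exp_vertex : finType := {i : I & 'I_(s i)}.

Definition copy (i : I) (r : 'I_(s i)) : exp_vertex :=
  Tagged (fun i => 'I_(s i)) r.

(* Only the values of r on F matter. When all s i are positive, every tuple
   in the product of the 'I_(s i) for i in F extends to such an r. *)
Definition copy_set (F : {set I}) (r : {dffun forall i : I, 'I_(s i)}) :
  {set exp_vertex} := [set copy (r i) | i in F].

Definition exp_facets : {set {set exp_vertex}} :=
  [set copy_set F r | F in facets D, r in {: {dffun forall i : I, 'I_(s i)}}].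

Definition exp_faces : {set {set exp_vertex}} :=
  [set G : {set exp_vertex} | [exists H in exp_facets, G \subset H]].

Hypothesis s_gt0 : forall i, 0 < s i.

Lemma exp_face_vertex (v : exp_vertex) : [set v] \in exp_faces.
Proof.
case: v => i r.
have [F maxF iF] := @maxset_exists _ (fun G => G \in faces D) _ (face_vertex D i).
pose f : forall k, 'I_(s k) := dfwith (fun k => Ordinal (s_gt0 k)) r.
rewrite inE; apply/exists_inP; exists (copy_set F (finfun f)).
  by apply/imset2P; exists F (finfun f); rewrite // inE.
rewrite sub1set; apply/imsetP; exists i; first by rewrite -sub1set.
by rewrite ffunE /f dfwith_in.
Qed.

Lemma exp_face_sub (F G : {set exp_vertex}) :
  F \in exp_faces -> G \subset F -> G \in exp_faces.
Proof.
rewrite !inE => /exists_inP[H HP sFH] sGF; apply/exists_inP; exists H => //.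
exact: subset_trans sFH.
Qed.

Definition expansion : simplicial_complex exp_vertex :=
  SimplicialComplex exp_face_vertex exp_face_sub.

Lemma copy_set_proj (F : {set I}) r : [set tag v | v in copy_set F r] = F.
Proof.
by rewrite /copy_set -imset_comp (eq_imset _ (g := id)) ?imset_id.
Qed.

Lemma facets_expansion : facets expansion = exp_facets.
Proof.
have sub H : H \in exp_facets -> H \in exp_faces.
  by move=> HP; rewrite inE; apply/exists_inP; exists H.
apply/setP => G; rewrite inE; apply/maxsetP/idP => [[]|GP].
  rewrite inE => /exists_inP[H HP sGH] maxG.
  by rewrite -(maxG H (sub H HP) sGH).
split=> [|K]; first exact: sub.
rewrite inE => /exists_inP[H HP sKH] sGK.
have sGH := subset_trans sGK sKH.
suff eqGH : G = H by apply/eqP; rewrite eqEsubset sGK andbT eqGH.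
have /imset2P[F r FP _ defG] := GP; have /imset2P[F' r' F'P _ defH] := HP.
have eqFF' : F' = F.
  move: FP F'P; rewrite !inE => /maxsetP[_ maxF] /maxsetP[F'D _].
  apply: maxF => //; rewrite -(copy_set_proj F r) -(copy_set_proj F' r').
  by rewrite -defG -defH imsetS.
apply/eqP; rewrite eqEcard sGH defG defH eqFF' /=.
have card R : #|copy_set F R| = #|F|.
  by apply: card_in_imset => i j _ _ /(congr1 (@tag _ _)).
by rewrite !card.
Qed.

End Expansion.

(* Main.v *)
Require Import Defs.
From mathcomp Require Import all_boot.

Set Implicit Arguments.
Unset Strict Implicit.
Unset Printing Implicit Defensive.

(** Order the facets of the expansion lexicographically, first by the position
of their projection in a shelling of [D], then by the sum of their copy
numbers.  For facets G < H with distinct projections, the shelling of [D]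
provides a vertex v and an earlier facet of [D], and it suffices to copy the
latter with the copy numbers of H.  If the projections agree, some vertex has
a smaller copy number in G than in H, and replacing this single copy number in
H gives a facet of smaller sum. *)

(** Sorting the facets by [w] gives the shelling. Ties are broken arbitrarily, so the hypothesis
    covers all pairs with [w G <= w H], while the strictly smaller weight of [K] forces it to
    precede [H]. *)
Lemma shellable_by_weight (V : finType) (D : simplicial_complex V)
    (w : {set V} -> nat) :
    (forall G H, G \in facets D -> H \in facets D -> G != H -> w G <= w H ->
       exists2 v : V, v \in H :\: G
       & exists2 K, K \in facets D & w K < w H /\ H :\: K = [set v]) ->
  shellable D.
Proof.
move=> step; pose le_w := relpre w leq.
have le_w_trans : transitive le_w by move=> ? ? ?; apply: leq_trans.
have le_w_total : total le_w by move=> ? ?; apply: leq_total.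
pose Fs := sort le_w (enum (facets D)).
have FsE : Fs =i facets D by move=> G; rewrite mem_sort mem_enum.
have uFs : uniq Fs by rewrite sort_uniq enum_uniq.
have le_nth i j : i <= j -> j < size Fs -> w (nth set0 Fs i) <= w (nth set0 Fs j).
  move=> le_ij lt_j; have lt_i := leq_ltn_trans le_ij lt_j.
  have le_w_refl : reflexive le_w by move=> ?; apply: leqnn.
  exact: (sorted_leq_nth le_w_trans le_w_refl set0 (sort_sorted le_w_total _)).
exists Fs; split=> // i j lt_ij lt_j; have lt_i := ltn_trans lt_ij lt_j.
have [||||v vP [K KP [ltK KE]]] := step (nth set0 Fs i) (nth set0 Fs j).
- by rewrite -FsE mem_nth.
- by rewrite -FsE mem_nth.
- by rewrite nth_uniq // ltn_eqF.
- exact/le_nth/lt_j/ltnW.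
exists v => //; move: KP; rewrite -FsE => KP.
exists (index K Fs); last by rewrite nth_index.
(* At position [j] or later, [K] would weigh at least as much as the facet at [j]. *)
rewrite ltnNge; apply: contraL ltK => le_jK.
by rewrite -leqNgt -[K in _ <= w K](nth_index set0 KP) le_nth ?index_mem.
Qed.

Section CopySets.

Variables (I : finType) (s : I -> nat).
Implicit Types (F : {set I}) (r : {dffun forall i : I, 'I_(s i)}).

Lemma mem_copy_set F r (v : exp_vertex s) :
  (v \in copy_set F r) = (tag v \in F) && (tagged v == r (tag v)).
Proof.
apply/imsetP/andP => [[i iF ->] //|[vF /eqP vE]].
by exists (tag v) => //; rewrite -vE; case: v {vF vE}.
Qed.

(** For a common [r], copying is injective on vertices and so commutes with set difference. *)
Lemma copy_setD1 F F' r v : F :\: F' = [set v] ->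
  copy_set F r :\: copy_set F' r = [set copy (r v)].
Proof.
move=> FE; rewrite -[RHS](imset_set1 (fun i => copy (r i))) -FE.
apply/setP=> u; rewrite !inE -/(copy_set _ _) !mem_copy_set !inE.
by case: (tag u \in F'); case: (tag u \in F); case: eqP.
Qed.

Definition recopy r k (a : 'I_(s k)) : {dffun forall i : I, 'I_(s i)} :=
  finfun (dfwith r a).

Lemma copy_set_recopyD F r k a : k \in F -> a != r k ->
  copy_set F r :\: copy_set F (recopy r a) = [set copy (r k)].
Proof.
move=> kF neq_a; apply/setP=> -[i b]; rewrite !inE !mem_copy_set /= ffunE.
(* The type of [b] depends on [i], so [b] is generalised before [i] is identified with [k]. *)
case: (eqVneq k i) b => [<-|neq_ki] b.
  rewrite dfwith_in kF /= /copy eq_Tagged /=.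
  have [->|] := eqVneq b (r k); last by rewrite andbF.
  by rewrite [r k == a]eq_sym neq_a.
rewrite dfwith_out // andNb; apply/esym/eqP=> /(congr1 tag) /= /eqP.
by rewrite eq_sym (negPf neq_ki).
Qed.

Definition copy_weight (G : {set exp_vertex s}) : nat :=
  \sum_(v in G) (tagged v : nat).

Lemma copy_weightE F r : copy_weight (copy_set F r) = \sum_(i in F) r i.
Proof.
by rewrite /copy_weight big_imset // => i j _ _ /(congr1 (@tag _ _)).
Qed.

Lemma copy_weight_recopy F r k (a : 'I_(s k)) : k \in F -> a < r k ->
  copy_weight (copy_set F (recopy r a)) < copy_weight (copy_set F r).
Proof.
move=> kF lt_a; rewrite !copy_weightE (bigD1 k) //= [ltnRHS](bigD1 k) //=.
rewrite ffunE dfwith_in.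
(* The successor goes to the term at [k], where the inequality is strict; the other terms are
   equal. *)
rewrite -addSn leq_add // leq_sum // => i /andP[_ neq_ik].
by rewrite ffunE dfwith_out // eq_sym.
Qed.

(** Otherwise [r'] is at most [r] throughout [F]. The assumed inequality of sums then forces
    equality term by term, so that the two copies of [F] coincide. *)
Lemma copy_weight_lt_coord F r r' :
    copy_set F r != copy_set F r' ->
    copy_weight (copy_set F r) <= copy_weight (copy_set F r') ->
  exists2 k, k \in F & r k < r' k.
Proof.
move=> neq_rr'; rewrite !copy_weightE => le_rr'.
apply/exists_inP; apply: contraNT neq_rr'.
rewrite negb_exists_in => /forall_inP ge_rr'.
have := leqif_sum (fun i (iF : i \in F) =>
  leqif_eq (etrans (leqNgt (r' i) (r i)) (ge_rr' i iF))).
case=> le_r'r; rewrite eqn_leq le_r'r le_rr' => /esym/forall_inP eq_rr'.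
apply/eqP/eq_in_imset=> i iF; congr copy; apply/val_inj/esym/eqP.
exact: eq_rr'.
Qed.

End CopySets.

Lemma shellable_expansion (I : finType) (D : simplicial_complex I)
    (s : I -> nat) (s_gt0 : forall i, 0 < s i) :
  shellable D -> shellable (expansion D s_gt0).
Proof.
case=> Fs [uFs FsE shell].
(* As [M] exceeds every copy weight, [w] encodes in one number the lexicographic order on pairs of
   position and copy weight. *)
pose M := (\sum_(v : exp_vertex s) (tagged v : nat)).+1.
pose pos (G : {set exp_vertex s}) := index [set tag v | v in G] Fs.
have lt_M (G : {set exp_vertex s}) : copy_weight G < M.
  by rewrite ltnS /copy_weight big_mkcond leq_sum // => v _; case: ifP.
pose w G := pos G * M + copy_weight G.
have lt_w G H : pos G < pos H -> w G < w H.
  move=> lt_GH; apply: (@leq_trans ((pos G).+1 * M)).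
    by rewrite mulSnr ltn_add2l.
  by apply: leq_trans (leq_addr _ _); rewrite leq_mul2r lt_GH orbT.
have posE F r : pos (copy_set F r) = index F Fs by rewrite /pos copy_set_proj.
have copyP F r : F \in Fs -> copy_set F r \in facets (expansion D s_gt0).
  by move=> FP; rewrite facets_expansion; apply/imset2P; exists F r; rewrite -?FsE.
apply: (@shellable_by_weight _ _ w) => G H.
rewrite {1 2}facets_expansion.
case/imset2P=> F r; rewrite -FsE => FP _ -> {G}.
case/imset2P=> F' r'; rewrite -FsE => F'P _ -> {H} neq_GH le_w.
have : index F Fs <= index F' Fs.
  by rewrite leqNgt; apply: contraL le_w => lt_F; rewrite -ltnNge lt_w ?posE.
rewrite leq_eqVlt => /predU1P[eq_F | lt_F].
  have {}eq_F : F = F' by rewrite -(nth_index set0 FP) eq_F nth_index.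
  rewrite {F FP}eq_F in neq_GH le_w *.
  move: le_w; rewrite /w !posE leq_add2l => le_w.
  have [k kF lt_k] := copy_weight_lt_coord neq_GH le_w.
  have neq_k : r k != r' k by rewrite neq_ltn lt_k.
  exists (copy (r' k)).
    by rewrite inE !mem_copy_set /= kF eqxx eq_sym neq_k.
  exists (copy_set F' (recopy r' (r k))); first exact: copyP.
  (* The projection is unchanged, so the positions cancel and only copy weights are compared. *)
  by rewrite copy_set_recopyD // /w !posE ltn_add2l copy_weight_recopy.
have [|v] := shell _ _ lt_F; first by rewrite index_mem.
rewrite !nth_index // inE => /andP[vF vF'] [l lt_l FE].
have lt_ls : l < size Fs by rewrite (ltn_trans lt_l) ?index_mem.
(* Since [v] is not in [F], no copy of it lies in [copy_set F r]. The new facet has position [l], so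
   it is lighter whatever its copy numbers. *)
exists (copy (r' v)); first by rewrite inE !mem_copy_set /= (negPf vF) vF' eqxx.
exists (copy_set (nth set0 Fs l) r'); first exact/copyP/mem_nth.
by rewrite (copy_setD1 _ FE) lt_w ?posE ?index_uniq.
Qed.

Theorem theorem2p12 (n : nat) (D : simplicial_complex 'I_n) (s : 'I_n -> nat)
    (s_gt0 : forall i : 'I_n, 0 < s i) :
  shellable D -> shellable (expansion D s_gt0).
Proof. exact: shellable_expansion. Qed.
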